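(* For each $N$ let $p=(p_1,\ldots,p_N)\in(0,1)^N$ and an integer $I$ with $1\le I\le N/2$ be random, and let $w_n=p_n/(1-p_n)$. Suppose that: (i) there exist $\zeta>0$, $0<l<r<\infty$ and $\eta>0$ such that for all $N$ large enough, \[\mathbb{P}\left(\left|\left\{n\in[N]: w_n\notin(l,r)\right\}\right|\le \zeta N\right)\ge 1-\exp(-\eta N);\] (ii) there exist $0<\xi\le 1/2$ and $\eta'>0$ such that for all $N$ large enough, \[\mathbb{P}(\xi N\le I)\ge 1-\exp(-\eta' N);\] and that these hold with $\zeta<\xi$. Let $(x^{(t)})_{t\ge 0}$ be the swap Markov chain with transition kernel $P$ (defined in the context, for given $p$ and $I$), started from $x^{(0)}\sim\pi_0$. Then there exist $\kappa>0$, $\nu>0$ and $N_0\in\mathbb{N}$, independent of $N$, such that for any $\epsilon\in(0,1)$ and for all $N\ge N_0$, with probability at least $1-\exp(-\nu N)$ (under the distribution of $(p,I)$), we have \[\|x^{(t)}-\mathrm{CB}(p,I)\|_{\mathrm{TV}}\le\epsilon\quad\text{for all}\quad t\ge\kappa N\log(N/\epsilon).\]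
   Context: Notation: $[N]=\{1,\ldots,N\}$, and $|\cdot|$ is the cardinality of a set. For $p\in(0,1)^N$ and an integer $I$, $\mathbb{X}=\{x\in\{0,1\}^N:\sum_{n=1}^N x_n=I\}$, and the odds are $w_n=p_n/(1-p_n)$. The conditional Bernoulli distribution $\mathrm{CB}(p,I)$ is the law on $\mathbb{X}$ of a vector of independent Bernoulli$(p_n)$ variables, $n\in[N]$, conditioned on their sum being equal to $I$; i.e. the mass of $x\in\mathbb{X}$ is proportional to $\prod_{n: x_n=1} w_n$. Swap Markov chain: the transition kernel $P(x,\cdot)$ on $\mathbb{X}$ is defined as follows. With $S_z=\{n\in[N]:x_n=z\}$ for $z\in\{0,1\}$, sample $i_0$ uniformly in $S_0$ and $i_1$ uniformly in $S_1$, independently; propose the state obtained from $x$ by setting $x_{i_0}=1$ and $x_{i_1}=0$, and accept it (move to it) with probability $\min(1,w_{i_0}/w_{i_1})$; otherwise stay at $x$. The initial distribution $\pi_0$ is an arbitrary probability distribution on $\mathbb{X}$ (it may depend on $N,p,I$). The probabilities $p$ (equivalently the odds) and $I$ are random, with a joint distribution for each $N$; no independence is assumed. The Markov chain is considered conditionally on $(p,I)$, and $\|x^{(t)}-\mathrm{CB}(p,I)\|_{\mathrm{TV}}$ denotes the total variation distance between the law of $x^{(t)}$ (given $(p,I)$) and $\mathrm{CB}(p,I)$. *)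

(* Defs.v *)
From HB Require Import structures.
From mathcomp Require Import all_boot all_order all_algebra.
From mathcomp Require Import all_classical all_reals all_analysis.

Set Implicit Arguments.
Unset Strict Implicit.
Unset Printing Implicit Defensive.

Import Order.TTheory GRing.Theory Num.Theory.
Import numFieldNormedType.Exports.

Local Open Scope ring_scope.

Definition slice (N I : nat) : finType :=
  {x : {ffun 'I_N -> bool} | (\sum_(n < N) x n)%N == I}.

Definition odds (R : realType) (p : R) : R := p / (1 - p).

Definition ones N (x : {ffun 'I_N -> bool}) : {set 'I_N} := [set n | x n]%SET.

Definition zeros N (x : {ffun 'I_N -> bool}) : {set 'I_N} := [set n | ~~ x n]%SET.

Definition swap N (x : {ffun 'I_N -> bool}) (i0 i1 : 'I_N) :
    {ffun 'I_N -> bool} :=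
  [ffun n => if n == i0 then true else if n == i1 then false else x n].

Definition accept (R : realType) N (p : 'I_N -> R) (i0 i1 : 'I_N) : R :=
  Num.min 1 (odds (p i0) / odds (p i1)).

(* Several pairs (i0, i1) may contribute to the staying probability P(x, x),
   hence the summation over the proposals. *)
Definition swap_kernel (R : realType) N I (p : 'I_N -> R)
    (x y : slice N I) : R :=
  \sum_(i0 in zeros (val x)) \sum_(i1 in ones (val x))
    #|zeros (val x)|%:R^-1 * #|ones (val x)|%:R^-1 *
    (accept p i0 i1 * (val y == swap (val x) i0 i1)%:R
     + (1 - accept p i0 i1) * (y == x)%:R).

(* The law of the chain at time t, as a mass function on the slice. *)
Fixpoint swap_law (R : realType) N I (p : 'I_N -> R) (pi0 : slice N I -> R)
    (t : nat) : slice N I -> R :=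
  if t is t'.+1 then
    fun y => \sum_(x : slice N I) swap_law p pi0 t' x * swap_kernel p x y
  else pi0.

Definition indep_bernoulli_pmf (R : realType) N (p : 'I_N -> R)
    (x : {ffun 'I_N -> bool}) : R :=
  \prod_(n < N) bernoulli_pmf (p n) (x n).

Definition cond_bernoulli (R : realType) N I (p : 'I_N -> R)
    (x : slice N I) : R :=
  indep_bernoulli_pmf p (val x)
  / \sum_(y : slice N I) indep_bernoulli_pmf p (val y).

Definition is_pmf (R : realType) (T : finType) (mu : T -> R) : Prop :=
  (forall x, 0 <= mu x) /\ \sum_(x : T) mu x = 1.

(* The maximum is over all events; 0 is only the value of an empty maximum. *)
Definition tv_dist (R : realType) (T : finType) (mu nu : T -> R) : R :=
  \big[Num.max/0]_(A : {set T}) `|\sum_(x in A) mu x - \sum_(x in A) nu x|.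

(* "E holds with probability at least q", also meaningful when the measurability
   of E is not assumed. *)
Definition holds_with_prob d (T : measurableType d) (R : realType)
    (P : probability T R) (q : R) (E : set T) : Prop :=
  exists A : set T, [/\ measurable A, (A `<=` E)%classic & (q%:E <= P A)%E].

Lemma holds_with_probE d (T : measurableType d) (R : realType)
    (P : probability T R) (q : R) (E : set T) :
  measurable E -> holds_with_prob P q E <-> (q%:E <= P E)%E.
Proof.
move=> mE; split=> [[A [mA AE qA]]|qE]; last by exists E; split.
by apply: (le_trans qA); apply: le_measure AE; rewrite inE.
Qed.

(* Main.v *)
(* The argument is path coupling in its dual form.  Join two states that differ
   by moving a single 1 from a to b, and give this edge the weight 1 + dl when
   one of w_a, w_b is <= l and the other >= r, and the weight 1 otherwise.  The
   kernel contracts the Lipschitz seminorm of test functions for these weights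
   by a factor 1 - const/N.  Indeed, pair the proposals from the two states by
   exchanging a and b; Hamming distance never grows.  On an edge of weight 1,
   the linearly many "good" coordinates (odds in (l,r)) among the common ones or
   the common zeros make the two copies merge, each with acceptance probability
   at least l/r, which outweighs the risk, of cost dl, of reaching a heavy edge.
   From a heavy edge, every good common one leads to merging or to a light edge.
   Any two states are joined by at most N edges and the conditional Bernoulli law
   is reversible, hence stationary, so iterating the contraction bounds the total
   variation distance by 2 N (1 - const/N)^t. *)
Require Import Defs.
From HB Require Import structures.
From mathcomp Require Import all_boot all_order all_algebra.
From mathcomp Require Import perm.
From mathcomp Require Import all_classical all_reals all_analysis.
From mathcomp Require Import measurable_realfun.
From mathcomp Require Import ring lra.
Import Order.TTheory GRing.Theory Num.Theory.
Import numFieldNormedType.Exports.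
Local Open Scope classical_set_scope.
Local Open Scope ring_scope.

Set Implicit Arguments.
Unset Strict Implicit.
Unset Printing Implicit Defensive.

(** * Exchanges of two coordinates and Hamming distance on a slice *)

Section Flip.
Variables (N J : nat).
Implicit Types (x y : slice N J) (i j n : 'I_N).

Lemma flip_subproof x i j :
  (\sum_(n < N) [ffun k => val x (tperm i j k)] n)%N == J.
Proof.
rewrite -[X in _ == X](eqP (valP x)); apply/eqP.
rewrite [RHS](reindex_inj (@perm_inj _ (tperm i j))) /=.
by apply: eq_bigr => k _; rewrite ffunE.
Qed.

(* Unlike [swap], which is meant for x_i = 0 and x_j = 1, this exchanges the
   coordinates i and j unconditionally, hence is an involution of the slice. *)
Definition flip i j x : slice N J :=
  exist (fun y : {ffun 'I_N -> bool} => (\sum_(n < N) y n)%N == J)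
    _ (flip_subproof x i j).

Lemma flipE i j x n : val (flip i j x) n = val x (tperm i j n).
Proof. by rewrite ffunE. Qed.

Lemma flipC i j : flip i j =1 flip j i.
Proof. by move=> x; apply/val_inj/ffunP => n; rewrite !flipE tpermC. Qed.

Lemma flipK i j : involutive (flip i j).
Proof. by move=> x; apply/val_inj/ffunP => n; rewrite !flipE tpermK. Qed.

(** Transpositions conjugate by relabelling. Thus a proposal from [flip a b x], relabelled by
    [tperm a b], is the image under [flip a b] of the original proposal from [x]; this is what makes
    the pairing of proposals work. *)
Lemma flip_conj x a b i j :
  flip (tperm a b i) (tperm a b j) (flip a b x) = flip a b (flip i j x).
Proof.
apply/val_inj/ffunP => n; rewrite !flipE.
by rewrite (inj_tperm _ _ _ (@perm_inj _ (tperm a b))) !tpermK.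
Qed.

Lemma flip_id x a b : val x a = val x b -> flip a b x = x.
Proof.
by move=> xab; apply/val_inj/ffunP => n; rewrite flipE; case: tpermP => [->|->|].
Qed.

Lemma swap_flip x i0 i1 :
  ~~ val x i0 -> val x i1 -> swap (val x) i0 i1 = val (flip i0 i1 x).
Proof.
move=> x0 x1; apply/ffunP => n; rewrite flipE ffunE.
by case: tpermP => [->|->|/eqP/negPf-> /eqP/negPf->]//;
  rewrite eqxx ?x1 // (negPf x0); case: eqP => // ji; rewrite -ji x1 in x0.
Qed.

Lemma card_ones x : #|ones (val x)| = J.
Proof.
rewrite -[RHS](eqP (valP x)) -sum1_card big_mkcond /=.
by apply: eq_bigr => n _; rewrite inE; case: (val x n).
Qed.

Lemma card_zeros x : #|zeros (val x)| = (N - J)%N.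
Proof.
have /(congr1 (subn^~ J)) := cardsC (ones (val x)).
rewrite card_ones card_ord addKn => <-.
by apply: eq_card => n; rewrite !inE.
Qed.

Definition hamming x y := #|[pred n | val x n != val y n]|.

(** Otherwise the ones of [x] would be contained in those of [y], and both sets have [J]
    elements. *)
Lemma slice_diff x y : x != y -> exists n, val x n && ~~ val y n.
Proof.
move=> xy; apply/existsP; apply: contraNT xy; rewrite negb_exists => /forallP H.
have sub : ones (val x) \subset ones (val y).
  apply/fintype.subsetP => n; rewrite !inE => xn.
  by have := H n; rewrite xn /= negbK.
have : ones (val x) == ones (val y) by rewrite finset.eqEcard sub !card_ones leqnn.
move=> /eqP/setP E; apply/eqP/val_inj/ffunP => n.
by have := E n; rewrite !inE.
Qed.

(** The exchange repairs the disagreement at [a] and creates none, so each edge of the path from [x]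
    to [y] makes progress. *)
Lemma hamming_flip x y a b : val x a -> ~~ val y a -> ~~ val x b -> val y b ->
  (hamming (flip a b x) y < hamming x y)%N.
Proof.
move=> xa ya xb yb; apply/proper_card/fintype.properP; split; last first.
  exists a; rewrite !inE ?flipE ?tpermL; first by rewrite xa (negPf ya).
  by rewrite (negPf xb) (negPf ya).
apply/fintype.subsetP => n; rewrite !inE flipE.
by case: tpermP => [->|->|//]; rewrite ?xa ?yb ?(negPf xb) ?(negPf ya).
Qed.

End Flip.

(** * The kernel as an operator on functions, and detailed balance *)

Section Step.
Variables (R : realType) (N J : nat) (p : 'I_N -> R).
Implicit Types (x y : slice N J) (i j n a b : 'I_N) (g : slice N J -> R).

(* The kernel acting on test functions, as opposed to measures. *)
Definition step g x : R := \sum_(y : slice N J) swap_kernel p x y * g y.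

Definition propose i0 i1 g x : R :=
  accept p i0 i1 * g (flip i0 i1 x) + (1 - accept p i0 i1) * g x.

Lemma sum_delta g x : \sum_y (y == x)%:R * g y = g x.
Proof.
rewrite (bigD1 x) //= eqxx mul1r big1 ?addr0 // => y /negPf ->.
by rewrite mul0r.
Qed.

(** Every state of the slice has [N - J] zeros and [J] ones, so the proposal probability is the same
    everywhere and leaves the sum. *)
Lemma stepE g x : step g x =
  ((N - J)%:R^-1 * J%:R^-1) *
  \sum_(i0 | ~~ val x i0) \sum_(i1 | val x i1) propose i0 i1 g x.
Proof.
rewrite /step /swap_kernel.
under eq_bigr do rewrite mulr_suml.
rewrite exchange_big mulr_sumr /=; apply: eq_big => [i|i0]; first by rewrite inE.
rewrite inE => x0.
under eq_bigr do rewrite mulr_suml.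
rewrite exchange_big mulr_sumr /=; apply: eq_big => [i|i1]; first by rewrite inE.
rewrite inE => x1; rewrite card_ones card_zeros.
under eq_bigr do rewrite -(mulrA (_ / _)).
rewrite -mulr_sumr; congr (_ * _); rewrite (swap_flip x0 x1).
under eq_bigr do rewrite mulrDl -!mulrA.
by rewrite big_split /= -!mulr_sumr /propose; congr (_ * _ + _ * _); rewrite -sum_delta.
Qed.

(** Duality: moving the kernel from the law to the test function reduces mixing to the decay of the
    iterates of [step]. *)
Lemma swap_lawE pi0 t g : \sum_y swap_law p pi0 t y * g y =
  \sum_x pi0 x * iter t step g x.
Proof.
elim: t g => [|t IH] g //; rewrite iterSr -IH /=.
under eq_bigr do rewrite mulr_suml.
rewrite exchange_big /=; apply: eq_bigr => x _.
by rewrite mulr_sumr; apply: eq_bigr => y _; rewrite mulrA.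
Qed.

Hypothesis hp : forall n, 0 < p n < 1.

Lemma odds_gt0 n : 0 < odds (p n).
Proof. by have /andP[p0 p1] := hp n; rewrite divr_gt0 // subr_gt0. Qed.

Lemma indep_bernoulli_pmf_gt0 (x : {ffun 'I_N -> bool}) : 0 < indep_bernoulli_pmf p x.
Proof.
apply: prodr_gt0 => n _; have /andP[p0 p1] := hp n.
by rewrite /bernoulli_pmf; case: (x n) => //; rewrite subr_gt0.
Qed.

(** Detailed balance. Only the factors at [i0] and [i1] change, and after division by the common
    factors both sides are the minimum of the two odds. *)
Lemma indep_balance x i0 i1 : ~~ val x i0 -> val x i1 ->
  indep_bernoulli_pmf p (val x) * accept p i0 i1 =
  indep_bernoulli_pmf p (val (flip i0 i1 x)) * accept p i1 i0.
Proof.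
move=> x0 x1; have i10 : i1 != i0.
  by apply/eqP => E; rewrite -E x1 in x0.
have D2 (F : 'I_N -> R) :
    \prod_n F n = F i0 * (F i1 * \prod_(n | (n != i0) && (n != i1)) F n).
  by rewrite (bigD1 i0) //= (bigD1 i1).
rewrite /indep_bernoulli_pmf !D2.
rewrite !flipE tpermL tpermR (negPf x0) x1 /bernoulli_pmf.
set P1 := \prod_(_ < _ | _) _; set P2 := \prod_(_ < _ | _) _.
have -> : P2 = P1.
  apply: eq_bigr => n /andP[n0 n1]; rewrite flipE tpermD // eq_sym //.
have /andP[a0 a1] := hp i0; have /andP[b0 b1] := hp i1.
have := odds_gt0 i0; have := odds_gt0 i1.
rewrite /accept; set u := odds (p i0); set v := odds (p i1) => v0 u0.
have e1 : p i1 = v * (1 - p i1) by rewrite /v /odds mulfVK // subr_eq0 gt_eqF.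
have e0 : p i0 = u * (1 - p i0) by rewrite /u /odds mulfVK // subr_eq0 gt_eqF.
rewrite [in LHS]e1 [in RHS]e0.
have E : v * Num.min 1 (u / v) = u * Num.min 1 (v / u).
  rewrite !minr_pMr ?ltW // !mulr1.
  by rewrite mulrC divfK ?gt_eqF // [u * _]mulrC divfK ?gt_eqF // minC.
transitivity ((1 - p i0) * (1 - p i1) * P1 * (v * Num.min 1 (u / v))); first by ring.
by rewrite E; ring.
Qed.

End Step.

(** * Contraction of the weighted Lipschitz seminorm *)

Section Contraction.
Variables (R : realType) (N J : nat) (p : 'I_N -> R).
Hypothesis hp : forall n, 0 < p n < 1.
Variables (l r dl : R).
Hypotheses (hl : 0 < l) (hlr : l < r) (hdl : 0 < dl).
Implicit Types (x y : slice N J) (i j n a b : 'I_N) (g : slice N J -> R).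

Local Notation w n := (odds (p n)).

Let w0 n : 0 < w n. Proof. exact: odds_gt0. Qed.

Lemma accept_ge0 i j : 0 <= accept p i j.
Proof. by rewrite le_min ler01 divr_ge0 // ltW. Qed.

Lemma accept_le1 i j : accept p i j <= 1.
Proof. by rewrite ge_min lexx. Qed.

Lemma accept_homo i i' j : w i <= w i' -> accept p i j <= accept p i' j.
Proof.
move=> ii'; rewrite /accept le_min ge_min lexx /= ge_min; apply/orP; right.
by rewrite ler_pM2r // invr_gt0.
Qed.

Lemma accept_anti i j j' : w j <= w j' -> accept p i j' <= accept p i j.
Proof.
move=> jj'; rewrite /accept le_min ge_min lexx /= ge_min; apply/orP; right.
by rewrite ler_pM2l // lef_pV2 // posrE.
Qed.

Lemma accept_eq1 i j : w j <= w i -> accept p i j = 1.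
Proof. by move=> ji; apply: min_idPl; rewrite ler_pdivlMr // mul1r. Qed.

Lemma accept_ge i j : l < w i -> w j < r -> l / r <= accept p i j.
Proof.
move=> li jr; have r0 : 0 < r by exact: lt_trans hlr.
rewrite le_min ler_pdivrMr // mul1r ltW //=.
by rewrite ler_pM // ?ltW // ?invr_gt0 // ltf_pV2 // posrE.
Qed.

Definition pair_weight i j : R :=
  if (w i <= l) && (r <= w j) || (w j <= l) && (r <= w i) then 1 + dl else 1.

Lemma pair_weightC i j : pair_weight i j = pair_weight j i.
Proof. by rewrite /pair_weight orbC. Qed.

Lemma pair_weight_ge1 i j : 1 <= pair_weight i j.
Proof. by rewrite /pair_weight; case: ifP => // _; rewrite lerDl ltW. Qed.

Lemma pair_weight_le i j : pair_weight i j <= 1 + dl.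
Proof. by rewrite /pair_weight; case: ifP => // _; rewrite lerDl ltW. Qed.

Definition good j := w j \in `]l, r[.

Lemma pair_weight_good i j : good j -> pair_weight i j = 1.
Proof.
rewrite /good in_itv /= => /andP[lj jr].
by rewrite /pair_weight !leNgt lj jr !andbF.
Qed.

Definition swap_lipschitz (K : R) g := forall x a b, val x a -> ~~ val x b ->
  `|g x - g (flip a b x)| <= K * pair_weight a b.

(* [gain1 a b j] is the weight of the edge (a, b) minus the expected weight of
   the edge after the proposals (b, j) from x and (a, j) from [flip a b x], when
   j is a common one and w_a <= w_b: the copies merge if both accept, and are
   left at the edge (a, j) if only the first does.  [gain0 a b i] is the same
   for the proposals (i, a) and (i, b), when i is a common zero. *)
Definition gain1 a b j := pair_weight a b * accept p b j
  - (accept p b j - accept p a j) * pair_weight a j.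

Definition gain0 a b i := pair_weight a b * accept p i a
  - (accept p i a - accept p i b) * pair_weight i b.

Lemma norm_combo (c d u v U V : R) : 0 <= c -> 0 <= d -> `|u| <= U -> `|v| <= V ->
  `|c * u + d * v| <= c * U + d * V.
Proof.
move=> c0 d0 uU vV; apply: (le_trans (ler_normD _ _)).
by rewrite !normrM (ger0_norm c0) (ger0_norm d0) lerD // ler_wpM2l.
Qed.

(** Each copy accepts or refuses, and the difference of the two averages is rewritten as a
    combination, with nonnegative coefficients up to sign, of differences along single edges. The
    four cases say whether [i0] is [b] and whether [i1] is [a]; only the two mixed cases bring a
    gain. *)
Lemma propose_bound K g x a b i0 i1 : swap_lipschitz K g -> val x a -> ~~ val x b ->
  w a <= w b -> ~~ val x i0 -> val x i1 ->
  `|propose p i0 i1 g x - propose p (tperm a b i0) (tperm a b i1) g (flip a b x)| <=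
  K * (pair_weight a b - (((i0 == b) && (i1 != a))%:R * gain1 a b i1 +
                          ((i0 != b) && (i1 == a))%:R * gain0 a b i0)).
Proof.
move=> Lg xa xb wab x0 x1.
have neq i j : val x i -> ~~ val x j -> (i != j) * (j != i).
  move=> xi xj; have ij : i != j by apply: contraNneq xj => <-.
  by split; rewrite // eq_sym.
have [ab ba] := neq _ _ xa xb; have [ai0 i0a] := neq _ _ xa x0.
have [i1b bi1] := neq _ _ x1 xb; have [i1i0 i0i1] := neq _ _ x1 x0.
rewrite /propose flip_conj.
have Lxx' := Lg x a b xa xb.
case: (eqVneq i0 b) x0 => [->|i0b] x0; case: (eqVneq i1 a) x1 => [->|i1a] x1 /=;
  rewrite ?mul1r ?mul0r ?addr0 ?add0r ?subr0 ?tpermL ?tpermR.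
- rewrite (flipC b a) flipK (accept_eq1 wab).
  set A := accept p a b; set u := g x; set v := g _.
  have -> : 1 * v + (1 - 1) * u - (A * u + (1 - A) * v) = - A * (u - v) by ring.
  rewrite normrM normrN (ger0_norm (accept_ge0 a b)).
  by apply: (le_trans _ Lxx'); rewrite ler_piMl // accept_le1.
- have ai1 : a != i1 by rewrite eq_sym.
  rewrite [tperm a b i1]tpermD //.
  (* In [y] both [a] and [b] are ones, so [flip a b] fixes [y]: this is the state where the copies
     merge, and [flip a b x] is one edge [(a, i1)] away from it. *)
  set y := flip b i1 x.
  have ya : val y a by rewrite flipE tpermD // eq_sym.
  have yb : val y b by rewrite flipE tpermL.
  have yi : ~~ val y i1 by rewrite flipE tpermR.
  have yy : flip a b y = y by rewrite flip_id // ya yb.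
  have xE : flip a b x = flip a i1 y.
    by rewrite -{1}(flipK b i1 x) -flip_conj yy tpermR tpermD.
  rewrite yy /gain1.
  have := Lg y a i1 ya yi; rewrite -xE => Lyx'.
  set A := accept p b i1; set B := accept p a i1.
  set u := g x; set v := g (flip a b x); set z := g y.
  have -> : A * z + (1 - A) * u - (B * z + (1 - B) * v) =
    (A - B) * (z - v) + (1 - A) * (u - v) by ring.
  have A1 : 0 <= 1 - A by rewrite subr_ge0 accept_le1.
  have AB : 0 <= A - B by rewrite subr_ge0 accept_homo.
  by apply: (le_trans (norm_combo AB A1 Lyx' Lxx')); lra.
- have bi0 : b != i0 by rewrite eq_sym.
  rewrite [tperm a b i0]tpermD //.
  (* Here [a] and [b] are both zeros of the merging state [y], and the remaining edge is
     [(i0, b)]. *)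
  set y := flip i0 a x.
  have yb : ~~ val y b by rewrite flipE tpermD.
  have ya : ~~ val y a by rewrite flipE tpermR.
  have yi : val y i0 by rewrite flipE tpermL.
  have yy : flip a b y = y by rewrite flip_id // (negPf ya) (negPf yb).
  have xE : flip a b x = flip i0 b y.
    by rewrite -{1}(flipK i0 a x) -flip_conj yy tpermL tpermD.
  rewrite yy /gain0.
  have := Lg y i0 b yi yb; rewrite -xE => Lyx'.
  set A := accept p i0 a; set B := accept p i0 b.
  set u := g x; set v := g (flip a b x); set z := g y.
  have -> : A * z + (1 - A) * u - (B * z + (1 - B) * v) =
    (A - B) * (z - v) + (1 - A) * (u - v) by ring.
  have A1 : 0 <= 1 - A by rewrite subr_ge0 accept_le1.
  have AB : 0 <= A - B by rewrite subr_ge0 accept_anti.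
  by apply: (le_trans (norm_combo AB A1 Lyx' Lxx')); lra.
- have bi0 : b != i0 by rewrite eq_sym.
  have ai1 : a != i1 by rewrite eq_sym.
  rewrite (tpermD ai0 bi0) (tpermD ai1 bi1).
  set y := flip i0 i1 x.
  have ya : val y a by rewrite flipE tpermD.
  have yb : ~~ val y b by rewrite flipE tpermD.
  have Lyy' := Lg y a b ya yb.
  set A := accept p i0 i1; set u := g x; set v := g (flip a b x).
  set s := g y; set t := g (flip a b y).
  have -> : A * s + (1 - A) * u - (A * t + (1 - A) * v) =
    A * (s - t) + (1 - A) * (u - v) by ring.
  have A0 : 0 <= A by exact: accept_ge0.
  have A1 : 0 <= 1 - A by rewrite subr_ge0 accept_le1.
  by apply: (le_trans (norm_combo A0 A1 Lyy' Lxx')); lra.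
Qed.

Lemma sum_flip x a b (H : 'I_N -> R) (c : bool) :
  \sum_(i | val (flip a b x) i == c) H i =
  \sum_(i | val x i == c) H (tperm a b i).
Proof.
rewrite (reindex_inj (@perm_inj _ (tperm a b))) /=; apply: eq_bigl => i.
by rewrite flipE tpermK.
Qed.

Lemma step_diff K g x a b : (0 < J < N)%N -> swap_lipschitz K g ->
  val x a -> ~~ val x b -> w a <= w b ->
  `|step p g x - step p g (flip a b x)| <=
  K * (pair_weight a b - (\sum_(j | val x j && (j != a)) gain1 a b j +
     \sum_(i | ~~ val x i && (i != b)) gain0 a b i) / ((N - J)%:R * J%:R)).
Proof.
move=> /andP[J0 JN] Lg xa xb wab.
have J0' : 0 < J%:R :> R by rewrite ltr0n.
have NJ0' : 0 < (N - J)%:R :> R by rewrite ltr0n subn_gt0.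
have sumT (H : 'I_N -> 'I_N -> R) y : \sum_(i0 | ~~ val y i0) \sum_(i1 | val y i1) H i0 i1 =
    \sum_(i0 | val y i0 == false) \sum_(i1 | val y i1 == true) H i0 i1.
  apply: eq_big => [i|i _]; first by case: (val y i).
  by apply: eq_bigl => j; case: (val y j).
(* Reindexing by [tperm a b] lets both sums run over the proposals from [x]. *)
rewrite !stepE (sumT _ (flip a b x)) sum_flip.
under [X in _ - _ * X]eq_bigr do rewrite sum_flip.
rewrite -(sumT (fun i0 i1 => propose p (tperm a b i0) (tperm a b i1) g (flip a b x))).
rewrite -mulrBr -sumrB.
under eq_bigr do rewrite -sumrB.
rewrite normrM ger0_norm ?mulr_ge0 ?invr_ge0 ?ler0n //.
have cJ : #|[pred i1 | val x i1]| = J.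
  by rewrite -[RHS](card_ones x); apply: eq_card => i; rewrite !inE.
have cN : #|[pred i0 | ~~ val x i0]| = (N - J)%N.
  by rewrite -[RHS](card_zeros x); apply: eq_card => i; rewrite !inE.
apply: (@le_trans _ _ ((N - J)%:R^-1 * J%:R^-1 *
  \sum_(i0 | ~~ val x i0) \sum_(i1 | val x i1)
  K * (pair_weight a b - (((i0 == b) && (i1 != a))%:R * gain1 a b i1 +
                          ((i0 != b) && (i1 == a))%:R * gain0 a b i0)))).
  rewrite ler_wpM2l ?mulr_ge0 ?invr_ge0 ?ler0n //.
  apply: (le_trans (ler_norm_sum _ _ _)); apply: ler_sum => i0 x0.
  apply: (le_trans (ler_norm_sum _ _ _)); apply: ler_sum => i1 x1.
  exact: propose_bound.
under eq_bigr do rewrite -mulr_sumr sumrB sumr_const cJ.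
rewrite -mulr_sumr sumrB sumr_const cN mulrCA.
suff -> : \sum_(i0 | ~~ val x i0) \sum_(i1 | val x i1)
     (((i0 == b) && (i1 != a))%:R * gain1 a b i1 +
      ((i0 != b) && (i1 == a))%:R * gain0 a b i0) =
   \sum_(j | val x j && (j != a)) gain1 a b j +
     \sum_(i | ~~ val x i && (i != b)) gain0 a b i.
  rewrite -mulrnA -[pair_weight a b *+ _]mulr_natr natrM; set S := \sum_(j | _ && _) _ + _.
  rewrite le_eqVlt; apply/orP; left; apply/eqP; congr (_ * _); field.
  by rewrite !gt_eqF.
under eq_bigr do rewrite big_split /=.
rewrite big_split /=; congr (_ + _).
  rewrite (bigD1 b) //= [X in _ + X]big1 ?addr0; last first.
    move=> i /andP[_ /negPf ->]; rewrite big1 // => j _; by rewrite mul0r.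
  rewrite eqxx big_mkcondr; apply: eq_bigr => j _ /=.
  by case: ifP; rewrite ?mul1r ?mul0r.
rewrite big_mkcondr; apply: eq_bigr => i _ /=.
rewrite (bigD1 a) //= big1 ?addr0; last first.
  by move=> j /andP[_ /negPf ->]; rewrite andbF mul0r.
by rewrite eqxx andbT; case: ifP; rewrite ?mul1r ?mul0r.
Qed.

(** Here [al] is the profit from a good coordinate and [be] the loss allowed on every coordinate. *)
Lemma sum_gain_ge (P : pred 'I_N) (F : 'I_N -> R) (al be : R) :
  (forall j, P j -> (good j)%:R * al - be <= F j) ->
  al * #|[pred j | P j && good j]|%:R - be * #|P|%:R <= \sum_(j | P j) F j.
Proof.
move=> H; apply: (le_trans _ (ler_sum _ H)).
rewrite sumrB sumr_const -[be *+ _]mulr_natr lerD2r -sum1_card natr_sum mulr_sumr.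
rewrite big_mkcondr /=; apply: ler_sum => j _.
by case: (good j); rewrite ?mul1r ?mulr1 ?mul0r.
Qed.

Lemma gains_ge x a b (c : R) : 0 < c < 1 -> dl <= c * (l / (2 * r)) ->
  w a <= w b ->
  c * N%:R <= #|[pred j | val x j && (j != a) && good j]|%:R ->
  c * N%:R <= #|[pred i | ~~ val x i && (i != b) && good i]|%:R ->
  dl * c * N%:R <= \sum_(j | val x j && (j != a)) gain1 a b j +
     \sum_(i | ~~ val x i && (i != b)) gain0 a b i.
Proof.
move=> /andP[c0 c1] dlc wab c1N c0N.
have r0 : 0 < r by exact: lt_trans hlr.
have acc_ge0 i j := accept_ge0 i j.
have acc_le1 i j := accept_le1 i j.
have acc1 j : accept p a j <= accept p b j by exact: accept_homo.
have acc0 i : accept p i b <= accept p i a by exact: accept_anti.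
have wle i j := pair_weight_le i j.
have wge i j := pair_weight_ge1 i j.
(* Common ones and common zeros are disjoint, so a loss of [dl] on each of them costs at most
   [dl * N] in all. *)
have cN : #|[pred j | val x j && (j != a)]|%:R +
    #|[pred i | ~~ val x i && (i != b)]|%:R <= N%:R :> R.
  rewrite -natrD ler_nat -[X in (_ <= X)%N](card_ord N).
  rewrite -(cardC [pred j | val x j]) leq_add //; apply/subset_leq_card.
    by apply/fintype.subsetP => i; rewrite !inE => /andP[].
  by apply/fintype.subsetP => i; rewrite !inE => /andP[].
have gain1_ge j : accept p a j - dl <= gain1 a b j.
  have := acc_ge0 a j; have := acc_le1 b j; have := acc1 j.
  have := wle a j; have := wge a b; rewrite /gain1.
  set A := accept p b j; set B := accept p a j; set D := pair_weight a b.
  set W := pair_weight a j => D1 W1 BA A1 B0.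
  have : (A - B) * W <= (A - B) * (1 + dl) by rewrite ler_wpM2l // subr_ge0.
  have : 1 * A <= D * A by rewrite ler_wpM2r // (le_trans B0).
  have : (A - B) * dl <= 1 * dl by apply: ler_wpM2r; [exact: ltW|lra].
  lra.
have gain0_ge i : accept p i b - dl <= gain0 a b i.
  have := acc_ge0 i b; have := acc_le1 i a; have := acc0 i.
  have := wle i b; have := wge a b; rewrite /gain0.
  set A := accept p i a; set B := accept p i b; set D := pair_weight a b.
  set W := pair_weight i b => D1 W1 BA A1 B0.
  have : (A - B) * W <= (A - B) * (1 + dl) by rewrite ler_wpM2l // subr_ge0.
  have : 1 * A <= D * A by rewrite ler_wpM2r // (le_trans B0).
  have : (A - B) * dl <= 1 * dl by apply: ler_wpM2r; [exact: ltW|lra].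
  lra.
move: cN c1N c0N (@sum_gain_ge [pred j | val x j && (j != a)] (gain1 a b))
  (@sum_gain_ge [pred i | ~~ val x i && (i != b)] (gain0 a b)).
set n1 := #|_|; set n0 := #|_|; set g1 := #|_|; set g0 := #|_|.
set S1 := \sum_(j | _) _; set S0 := \sum_(i | _) _ => cN c1N c0N H1 H0.
have N0 : 0 <= N%:R :> R by exact: ler0n.
have g10 : 0 <= g1%:R :> R by exact: ler0n.
have g00 : 0 <= g0%:R :> R by exact: ler0n.
have lr0 : 0 < l / r by exact: divr_gt0.
(* The bound on [dl] makes the total loss at most half of the profit [l / r] per good coordinate. *)
have dlN : dl * N%:R <= (l / r) * (c * N%:R) - dl * N%:R.
  have : dl * N%:R <= c * (l / (2 * r)) * N%:R by rewrite ler_wpM2r.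
  have -> : l / (2 * r) = (l / r) / 2 by field; rewrite gt_eqF.
  lra.
have dlcN : dl * c * N%:R <= dl * N%:R.
  by rewrite ler_wpM2r // ler_piMr ?ltW.
have dln : dl * n1%:R + dl * n0%:R <= dl * N%:R by rewrite -mulrDr ler_wpM2l // ltW.
(* If w_a > l, the good common ones make up for the loss dl per coordinate; if
   w_b < r, the good common zeros do; otherwise the edge (a, b) is heavy, no
   coordinate incurs a loss and every good common one gains dl. *)
have [la|al] := ltP l (w a).
  have {}H1 := H1 (l / r) dl; have {}H0 := H0 0 dl.
  have : (l / r) * (c * N%:R) <= (l / r) * g1%:R by rewrite ler_wpM2l // ltW.
  suff : l / r * g1%:R - dl * n1%:R <= S1 /\ 0 * g0%:R - dl * n0%:R <= S0 by lra.
  split.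
    apply: H1 => j _; apply: le_trans (gain1_ge j); rewrite lerD2r.
    case: (boolP (good j)) => [|_]; rewrite ?mul0r ?mul1r //.
    by rewrite /good in_itv => /andP[_ jr]; exact: accept_ge.
  by apply: H0 => i _; apply: le_trans (gain0_ge i); rewrite lerD2r mulr0.
have [br|rb] := ltP (w b) r.
  have {}H1 := H1 0 dl; have {}H0 := H0 (l / r) dl.
  have : (l / r) * (c * N%:R) <= (l / r) * g0%:R by rewrite ler_wpM2l // ltW.
  suff : 0 * g1%:R - dl * n1%:R <= S1 /\ l / r * g0%:R - dl * n0%:R <= S0 by lra.
  split.
    by apply: H1 => j _; apply: le_trans (gain1_ge j); rewrite lerD2r mulr0.
  apply: H0 => i _; apply: le_trans (gain0_ge i); rewrite lerD2r.
  case: (boolP (good i)) => [|_]; rewrite ?mul0r ?mul1r //.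
  by rewrite /good in_itv => /andP[li _]; exact: accept_ge.
have D1 : pair_weight a b = 1 + dl by rewrite /pair_weight al rb.
have {}H1 := H1 dl 0; have {}H0 := H0 0 0.
have : dl * (c * N%:R) <= dl * g1%:R by rewrite ler_wpM2l // ltW.
suff : dl * g1%:R - 0 * n1%:R <= S1 /\ 0 * g0%:R - 0 * n0%:R <= S0 by lra.
split.
  apply: H1 => j _; rewrite /gain1 D1.
  have := acc_ge0 a j; have := acc_le1 b j; have := acc1 j; have := wle a j.
  have [gj|_] := boolP (good j).
    rewrite (pair_weight_good _ gj) (@accept_eq1 b j) /=; first by lra.
    by move: gj; rewrite /good in_itv /= => /andP[_ jr]; rewrite ltW // (lt_le_trans jr).
  set A := accept p b j; set B := accept p a j.
  set W := pair_weight a j => W1 BA A1 B0.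
  have : (A - B) * W <= (A - B) * (1 + dl) by rewrite ler_wpM2l // subr_ge0.
  have : 0 <= B * (1 + dl) by rewrite mulr_ge0 // addr_ge0 // ltW.
  by rewrite /= mul0r; lra.
apply: H0 => i _; rewrite /gain0 D1.
have := acc_ge0 i b; have := acc_le1 i a; have := acc0 i; have := wle i b.
set A := accept p i a; set B := accept p i b.
set W := pair_weight i b => W1 BA A1 B0.
have : (A - B) * W <= (A - B) * (1 + dl) by rewrite ler_wpM2l // subr_ge0.
have : 0 <= B * (1 + dl) by rewrite mulr_ge0 // addr_ge0 // ltW.
lra.
Qed.

Lemma step_contract (K : R) g (c : R) : (0 < J < N)%N -> 0 < c < 1 -> dl <= 1 ->
  dl <= c * (l / (2 * r)) ->
  (forall (x : slice N J) a, c * N%:R <= #|[pred j | val x j && (j != a) && good j]|%:R) ->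
  (forall (x : slice N J) b, c * N%:R <= #|[pred i | ~~ val x i && (i != b) && good i]|%:R) ->
  0 <= K -> swap_lipschitz K g -> swap_lipschitz (K * (1 - dl * c / 2 / N%:R)) (step p g).
Proof.
move=> JN c01 dl1 dlc C1 C0 K0 Lg.
have half (x : slice N J) a b : w a <= w b -> val x a -> ~~ val x b ->
    `|step p g x - step p g (flip a b x)| <=
    K * (1 - dl * c / 2 / N%:R) * pair_weight a b.
  move=> wab xa xb.
  apply: (le_trans (step_diff JN Lg xa xb wab)).
  rewrite -mulrA ler_wpM2l //.
  have := @gains_ge x a b c c01 dlc wab (C1 x a) (C0 x b).
  set S := _ + _ => SN.
  (* The gain is additive, whereas the contraction is relative to the weight; the bound 2 on weights
     explains the 2 in the rate. *)
  have : pair_weight a b <= 2 by apply: le_trans (pair_weight_le _ _) _; lra.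
  have := pair_weight_ge1 a b.
  set D := pair_weight a b => D1 D2.
  have /andP[J0 J1] := JN; have /andP[c0 _] := c01.
  have N0 : 0 < N%:R :> R by rewrite ltr0n (leq_trans _ J1).
  have J0' : 0 < J%:R :> R by rewrite ltr0n.
  have NJ0' : 0 < (N - J)%:R :> R by rewrite ltr0n subn_gt0.
  have dcN : 0 < dl * c / N%:R by rewrite !mulr_gt0 // invr_gt0.
  have : dl * c / N%:R <= S / ((N - J)%:R * J%:R).
    apply: (@le_trans _ _ (S / (N%:R * N%:R))).
      rewrite invfM mulrA ler_pM2r ?invr_gt0 //.
      by rewrite ler_pdivlMr.
    rewrite ler_wpM2l //.
      by apply: le_trans SN; rewrite !mulr_ge0 // ltW.
    rewrite lef_pV2 ?posrE ?mulr_gt0 // ler_pM // ?ler_nat ?leq_subr // ?ler0n //.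
    exact: ltnW.
  have : D * (dl * c / N%:R) <= 2 * (dl * c / N%:R) by rewrite ler_wpM2r // ltW.
  lra.
(* When the odds are in the other order, the same edge is read from its other endpoint. *)
move=> x a b xa xb; have [wab|/ltW wba] := leP (w a) (w b); first exact: half.
have := half (flip a b x) b a wba; rewrite !flipE tpermL tpermR => /(_ xa xb).
by rewrite (flipC b a) flipK distrC pair_weightC.
Qed.

(** Induction on the Hamming distance, along a path of edges of weight at most 2. *)
Lemma lipschitz_osc (K : R) g : dl <= 1 -> 0 <= K -> swap_lipschitz K g ->
  forall x y, `|g x - g y| <= 2 * K * N%:R.
Proof.
move=> dl1 K0 Lg.
suff H m : forall x y, (hamming x y <= m)%N -> `|g x - g y| <= 2 * K * m%:R.
  by move=> x y; apply: H; rewrite -[X in (_ <= X)%N](card_ord N) max_card.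
elim: m => [|m IH] x y xym; have [->|xy] := eqVneq x y;
  rewrite ?subrr ?normr0 ?mulr_ge0 ?ler0n //.
- have [n /andP[xn yn]] := slice_diff xy.
  move: xym; rewrite leqn0 => /eqP/card0_eq/(_ n).
  by rewrite !inE xn (negPf yn).
have [a /andP[xa ya]] := slice_diff xy.
have [b /andP[yb xb]] : exists n, val y n && ~~ val x n.
  by apply: slice_diff; rewrite eq_sym.
have hm : (hamming (flip a b x) y <= m)%N.
  by rewrite -ltnS; apply: leq_trans xym; apply: hamming_flip.
apply: (le_trans (ler_distD (g (flip a b x)) _ _)).
rewrite -(natr1 m) mulrDr mulr1 addrC lerD ?IH //.
apply: (le_trans (Lg _ _ _ xa xb)).
rewrite [2 * K]mulrC ler_wpM2l //.
by apply: le_trans (pair_weight_le _ _) _; lra.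
Qed.

End Contraction.

(** * Stationarity of the conditional Bernoulli law *)

Section Stationary.
Variables (R : realType) (N J : nat) (p : 'I_N -> R).
Hypothesis hp : forall n, 0 < p n < 1.
Implicit Types (x y : slice N J) (i j n a b : 'I_N) (g : slice N J -> R).

Lemma cond_bernoulli_pmf : (exists x : slice N J, true) ->
  is_pmf (@cond_bernoulli R N J p).
Proof.
move=> [x _].
have S0 : 0 < \sum_(y : slice N J) indep_bernoulli_pmf p (val y).
  rewrite (bigD1 x) //= ltr_wpDr ?indep_bernoulli_pmf_gt0 //.
  by apply: sumr_ge0 => y _; rewrite ltW // indep_bernoulli_pmf_gt0.
split=> [y|]; first by rewrite divr_ge0 // ltW // indep_bernoulli_pmf_gt0.
by rewrite -mulr_suml divff // gt_eqF.
Qed.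

Lemma step_sub g x : (0 < J < N)%N -> step p g x - g x =
  ((N - J)%:R^-1 * J%:R^-1) * \sum_i0 \sum_i1
    (~~ val x i0 && val x i1)%:R * (accept p i0 i1 * (g (flip i0 i1 x) - g x)).
Proof.
move=> /andP[J0 JN].
have J0' : J%:R != 0 :> R by rewrite pnatr_eq0 -lt0n.
have NJ0' : (N - J)%:R != 0 :> R by rewrite pnatr_eq0 -lt0n subn_gt0.
have E : g x = ((N - J)%:R^-1 * J%:R^-1) *
    \sum_(i0 in zeros (val x)) \sum_(i1 in ones (val x)) g x.
  rewrite !sumr_const card_ones card_zeros -mulrnA -[g x *+ _]mulr_natr natrM.
  by field; rewrite J0' NJ0'.
rewrite [in LHS]E stepE -mulrBr; congr (_ * _); rewrite big_mkcond [X in _ - X]big_mkcond.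
rewrite -sumrB; apply: eq_bigr => i0 _; rewrite inE.
case: (val x i0) => /=; first by rewrite subrr big1 // => i1 _; rewrite mul0r.
rewrite big_mkcond [X in _ - X]big_mkcond -sumrB; apply: eq_bigr => i1 _.
rewrite inE /propose; case: (val x i1); rewrite ?subrr ?mul0r //.
by rewrite mul1r; ring.
Qed.

Lemma step_stationary g : (0 < J < N)%N ->
  \sum_x @cond_bernoulli R N J p x * step p g x = \sum_x cond_bernoulli p x * g x.
Proof.
move=> JN; apply/eqP; rewrite -subr_eq0 -sumrB; apply/eqP.
(* [h] is the flow of mass through a proposal, up to the constant proposal probability. By detailed
   balance [flip i0 i1] reverses it, so the total flow into states cancels the flow out of them. *)
pose h i0 i1 x := (~~ val x i0 && val x i1)%:R * (cond_bernoulli p x * accept p i0 i1).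
have hflip i0 i1 x : h i0 i1 (flip i0 i1 x) = h i1 i0 x.
  rewrite /h !flipE tpermL tpermR.
  have [/andP[x1 x0]|_] := boolP (~~ val x i1 && val x i0).
    rewrite /= !mul1r /cond_bernoulli mulrAC (flipC i0) -(indep_balance hp x1 x0).
    by rewrite mulrAC.
  by rewrite !mul0r.
transitivity ((N - J)%:R^-1 * J%:R^-1 *
    \sum_i0 \sum_i1 \sum_x h i0 i1 x * (g (flip i0 i1 x) - g x)).
  under eq_bigr do rewrite -mulrBr step_sub // mulrCA.
  rewrite -mulr_sumr; congr (_ * _).
  under eq_bigr do rewrite mulr_sumr.
  rewrite exchange_big; apply: eq_bigr => i0 _ /=.
  under eq_bigr do rewrite mulr_sumr.
  rewrite exchange_big; apply: eq_bigr => i1 _ /=; apply: eq_bigr => x _.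
  by rewrite /h; ring.
apply/eqP; rewrite mulf_eq0; apply/orP; right; apply/eqP.
under eq_bigr do under eq_bigr do under eq_bigr do rewrite mulrBr.
under eq_bigr do under eq_bigr do rewrite sumrB.
under eq_bigr do rewrite sumrB.
rewrite sumrB exchange_big /=; apply/eqP; rewrite subr_eq0; apply/eqP.
apply: eq_bigr => i1 _; apply: eq_bigr => i0 _.
rewrite (reindex_inj (can_inj (flipK i0 i1))); apply: eq_bigr => x _ /=.
by rewrite hflip flipK.
Qed.

End Stationary.

(** * From contraction to total variation, for fixed [p] and [J] *)

(** Under the product of [mu] and [nu], the difference of the means is an average of differences of
    values of [h]. *)
Lemma pmf_osc (R : realType) (T : finType) (mu nu h : T -> R) (B : R) :
  is_pmf mu -> is_pmf nu -> (forall x y, `|h x - h y| <= B) ->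
  `|\sum_x mu x * h x - \sum_x nu x * h x| <= B.
Proof.
move=> [mu0 mu1] [nu0 nu1] hB.
have -> : \sum_x mu x * h x - \sum_x nu x * h x =
    \sum_x \sum_y mu x * nu y * (h x - h y).
  have -> : \sum_x mu x * h x = \sum_x \sum_y mu x * nu y * h x.
    by apply: eq_bigr => x _; rewrite -mulr_suml -mulr_sumr nu1 mulr1.
  have -> : \sum_x nu x * h x = \sum_y \sum_x mu x * nu y * h y.
    by apply: eq_bigr => y _; rewrite -mulr_suml -mulr_suml mu1 mul1r.
  rewrite [X in _ - X]exchange_big -sumrB; apply: eq_bigr => x _ /=.
  by rewrite -sumrB; apply: eq_bigr => y _; rewrite mulrBr.
have -> : B = \sum_x \sum_y mu x * nu y * B.
  under eq_bigr do rewrite -mulr_suml -mulr_sumr nu1 mulr1.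
  by rewrite -mulr_suml mu1 mul1r.
apply: (le_trans (ler_norm_sum _ _ _)); apply: ler_sum => x _.
apply: (le_trans (ler_norm_sum _ _ _)); apply: ler_sum => y _.
by rewrite normrM ger0_norm ?mulr_ge0 // ler_wpM2l // mulr_ge0.
Qed.

Lemma rate_bounds (R : realType) (l r zeta xi : R) :
  0 < l -> l < r -> 0 < zeta -> zeta < xi -> xi <= 1 / 2 ->
  let c := (xi - zeta) / 2 in let dl := c * (l / (2 * r)) in
  [/\ 0 < c < 1, 0 < dl <= 1 & 0 < dl * c / 2 <= 1].
Proof.
move=> l0 lr zeta0 zx x2 c dl.
have r0 : 0 < r by exact: lt_trans lr.
have c0 : 0 < c by rewrite divr_gt0 // subr_gt0.
have c1 : c < 1 by rewrite ltr_pdivrMr // mul1r; lra.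
have lr0 : 0 < l / (2 * r) by rewrite divr_gt0 // mulr_gt0.
have lr1 : l / (2 * r) <= 1 by rewrite ler_pdivrMr ?mulr_gt0 //; lra.
have dl0 : 0 < dl by rewrite mulr_gt0.
have dl1 : dl <= 1 by rewrite mulr_ile1 // ltW.
have dlc0 : 0 < dl * c by rewrite mulr_gt0.
have dlc1 : dl * c <= 1 by rewrite mulr_ile1 // ltW.
rewrite c0 c1 dl0 dl1 divr_gt0 //; split=> //=.
by rewrite ler_pdivrMr // mul1r (le_trans dlc1) // ler1n.
Qed.

Section Mixing.
Variables (R : realType) (N J : nat) (p : 'I_N -> R).
Hypothesis hp : forall n, 0 < p n < 1.
Variables (l r zeta xi : R).
Hypotheses (hl : 0 < l) (hlr : l < r) (hzeta : 0 < zeta) (hzx : zeta < xi).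
Hypotheses (hxi : xi <= 1 / 2) (hN : zeta * N%:R + 2 <= xi * N%:R).
Hypotheses (hJ : (1 <= J)%N) (hJN : (2 * J <= N)%N) (hxJ : xi * N%:R <= J%:R).

Local Notation c := ((xi - zeta) / 2).
Local Notation dl := (c * (l / (2 * r))).

(** At most [zeta * N] bad coordinates and [a] itself are discarded; by the 2 in [hN], half of the
    margin [(xi - zeta) * N] pays for [a]. *)
Lemma count_good (P : pred 'I_N) a :
  #|[pred n : 'I_N | odds (p n) \notin `]l, r[]|%:R <= zeta * N%:R ->
  xi * N%:R <= #|P|%:R ->
  c * N%:R <= #|[pred j | P j && (j != a) && good p l r j]|%:R.
Proof.
move=> hbad hP.
pose G := [pred j | P j && (j != a) && good p l r j].
pose Bd := [pred n : 'I_N | odds (p n) \notin `]l, r[].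
have cardU (A1 A2 : pred 'I_N) : (#|[predU A1 & A2]| <= #|A1| + #|A2|)%N.
  by rewrite -cardUI leq_addr.
have : (#|P| <= 1 + (#|G| + #|Bd|))%N.
  rewrite -(card1 a); apply: leq_trans (leq_add (leqnn _) (cardU _ _)).
  apply: leq_trans (cardU _ _); apply/subset_leq_card/fintype.subsetP => j Pj.
  rewrite !inE /good; case: (j == a) => //=; rewrite andbT.
  by move: Pj; rewrite unfold_in => ->; rewrite orbN.
rewrite -(ler_nat R) !natrD => hPR; move: hN hP hbad hPR.
rewrite -/G -/Bd [_ / 2 * _]mulrAC mulrBl.
move: (xi * N%:R) (zeta * N%:R) (#|P|%:R : R) (#|G|%:R : R) (#|Bd|%:R : R) => X Y u v z.
lra.
Qed.

(** By duality and stationarity, the two probabilities of an event are the means, under [pi0] and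
    the target, of the [t]-th iterate of its indicator, whose oscillation has decayed. *)
Lemma swap_law_tv pi0 t : is_pmf pi0 ->
  #|[pred n : 'I_N | odds (p n) \notin `]l, r[]|%:R <= zeta * N%:R ->
  tv_dist (swap_law p pi0 t) (@cond_bernoulli R N J p) <=
  2 * (1 - dl * c / 2 / N%:R) ^+ t * N%:R.
Proof.
move=> pi0P.
have N2 : (1 < N)%N by apply: leq_trans hJN; rewrite mul2n -addnn -addn1 leq_add.
have N1 : 1 <= N%:R :> R by rewrite ler1n ltnW.
have [c01 /andP[dl0 dl1] /andP[_ dlc1]] := rate_bounds hl hlr hzeta hzx hxi.
have JN : (0 < J < N)%N.
  by rewrite hJ (leq_trans _ hJN) // mul2n -addnn -[X in (X < _)%N]addn0 ltn_add2l.
have cardO (x : slice N J) : #|(fun j => val x j) : pred 'I_N| = J.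
  by rewrite -[RHS](card_ones x); apply: eq_card => i; rewrite inE unfold_in.
have cardZ (x : slice N J) : #|(fun j => ~~ val x j) : pred 'I_N| = (N - J)%N.
  by rewrite -[RHS](card_zeros x); apply: eq_card => i; rewrite inE unfold_in.
have hxNJ : xi * N%:R <= (N - J)%:R.
  apply: (le_trans hxJ); rewrite ler_nat leq_subRL; last by case/andP: JN => _ /ltnW.
  by rewrite addnn -mul2n.
set rho := 1 - _.
have rho0 : 0 <= rho.
  by rewrite subr_ge0 ler_pdivrMr ?(lt_le_trans ltr01) // mul1r (le_trans dlc1).
(* The slice is nonempty because [pi0] has total mass 1. *)
have [x0 _] : exists x : slice N J, true.
  case: pi0P => _; case: (pickP (fun x : slice N J => true)) => [x _ _|no]; first by exists x.
  by rewrite big1 => [/eqP|x _]; [rewrite eq_sym oner_eq0|have := no x].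
move=> hbad; apply: bigmax_le => [|A _]; first by rewrite !mulr_ge0 ?exprn_ge0 ?ler0n.
pose g x : R := (x \in A)%:R.
have sumA (mu : slice N J -> R) : \sum_(x in A) mu x = \sum_x mu x * g x.
  rewrite big_mkcond; apply: eq_bigr => x _; rewrite /g.
  by case: (x \in A); rewrite ?mulr1 ?mulr0.
have Lip : swap_lipschitz p l r dl (rho ^+ t) (iter t (step p) g).
  elim: t => [|t IH] /=.
    move=> x a b xa xb; rewrite expr0 mul1r; apply: le_trans (pair_weight_ge1 _ _ _ dl0 _ _).
    by rewrite /g; case: (_ \in _); case: (_ \in _); rewrite ?subrr ?subr0 ?sub0r ?normrN ?normr1 ?normr0.
  rewrite exprSr; apply: step_contract => //.
  - by move=> x a; apply: (@count_good (fun j => val x j)); rewrite ?cardO.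
  - by move=> x a; apply: (@count_good (fun j => ~~ val x j)); rewrite ?cardZ.
  - exact: exprn_ge0.
have stat h s : \sum_x cond_bernoulli p x * iter s (step p) h x =
    \sum_x @cond_bernoulli R N J p x * h x.
  by elim: s => //= s IH; rewrite step_stationary.
rewrite !sumA swap_lawE -(stat g t); apply: pmf_osc => //.
  by apply: cond_bernoulli_pmf => //; exists x0.
apply: lipschitz_osc Lip => //; exact: exprn_ge0.
Qed.

End Mixing.

(** The 2 in [2 / gam] produces the square of [eps / N]: one factor cancels [N], the other absorbs
    the leading 2 since [N] is at least 2. *)
Lemma geometric_mixing (R : realType) (gam eps : R) (N t : nat) :
  0 < gam <= 1 -> 0 < eps < 1 -> (2 <= N)%N ->
  2 / gam * N%:R * ln (N%:R / eps) <= t%:R ->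
  2 * (1 - gam / N%:R) ^+ t * N%:R <= eps.
Proof.
move=> /andP[gam0 gam1] /andP[e0 e1] N2 ht.
have N2' : 2 <= N%:R :> R by rewrite ler_nat.
have N0 : 0 < N%:R :> R by apply: lt_le_trans N2'.
have rho0 : 0 <= 1 - gam / N%:R.
  by rewrite subr_ge0 ler_pdivrMr // mul1r; lra.
have le1 : (1 - gam / N%:R) ^+ t <= expR (- (gam / N%:R * t%:R)).
  rewrite -(mulNr (_ / _)) expRM_natr lerXn2r ?nnegrE ?expR_ge0 //.
  exact: expR_ge1Dx.
have le2 : expR (- (gam / N%:R * t%:R)) <= (eps / N%:R) ^+ 2.
  have -> : (eps / N%:R) ^+ 2 = expR (- (2 * ln (N%:R / eps))).
    rewrite -mulrN expRM_natl expRN lnK ?posrE ?divr_gt0 //.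
    by rewrite invf_div.
  rewrite ler_expR lerN2.
  have -> : 2 * ln (N%:R / eps) = gam / N%:R * (2 / gam * N%:R * ln (N%:R / eps)).
    by field; rewrite !gt_eqF.
  by rewrite ler_wpM2l // divr_ge0 // ltW.
have le3 := le_trans le1 le2.
apply: (@le_trans _ _ (2 * (eps / N%:R) ^+ 2 * N%:R)).
  by rewrite ler_pM2r // ler_pM2l.
have -> : 2 * (eps / N%:R) ^+ 2 * N%:R = eps * (2 * eps / N%:R).
  by field; rewrite gt_eqF.
apply: ler_piMr; first exact: ltW.
by rewrite ler_pdivrMr // mul1r; lra.
Qed.

(** * Probability and measurability of the event on [p] and [I] *)

Lemma probability_setI_ge d (T : measurableType d) (R : realType)
    (P : probability T R) (A B : set T) (a b : R) :
  measurable A -> measurable B ->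
  ((1 - a)%:E <= P A)%E -> ((1 - b)%:E <= P B)%E ->
  ((1 - (a + b))%:E <= P (A `&` B))%E.
Proof.
move=> mA mB hA hB.
have mAB : measurable (A `&` B) by exact: measurableI.
have := probability_setC P mAB; rewrite setCI => E.
have : (P (~` A `|` ~` B) <= P (~` A) + P (~` B))%E.
  by apply: measureU2; exact: measurableC.
rewrite E !probability_setC //; move: hA hB.
rewrite -(fineK (fin_num_measure P _ mA)) -(fineK (fin_num_measure P _ mB)).
rewrite -(fineK (fin_num_measure P _ mAB)).
rewrite -!EFinB -EFinD !lee_fin; lra.
Qed.

Lemma measurable_card_pred d (T : measurableType d) (R : realType) (m : nat)
    (D : 'I_m -> set T) (c : R) : (forall n, measurable (D n)) ->
  measurable [set w | #|[pred n | w \in D n]|%:R <= c].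
Proof.
move=> mD.
pose f (w : T) : R := \sum_(n < m) \1_(D n) w.
have mf : measurable_fun setT f by apply: measurable_sum => n; exact: measurable_indic.
have fE w : f w = #|[pred n | w \in D n]|%:R.
  rewrite -sum1_card natr_sum [RHS]big_mkcond; apply: eq_bigr => n _.
  by rewrite indicE inE; case: (w \in D n).
have -> : [set w | #|[pred n | w \in D n]|%:R <= c] = setT `&` f @^-1` `]-oo, c].
  by rewrite setTI; apply/seteqP; split=> w /=; rewrite in_itv /= fE.
exact: mf.
Qed.

(** Halving the rate absorbs the factor 2 left by the union bound. *)
Lemma two_expR_half (R : realType) (nu x : R) : 0 < nu -> 2 / nu <= x ->
  expR (- (nu * x)) + expR (- (nu * x)) <= expR (- (nu / 2 * x)).
Proof.
move=> nu0 hx.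
have -> : - (nu * x) = - (nu / 2 * x) + - (nu / 2 * x) by field.
rewrite expRD -mulr2n -mulrnAl ler_piMl ?expR_ge0 // -mulr_natr expRN.
rewrite ler_pdivrMl ?expR_gt0 // mulr1; apply: le_trans (expR_ge1Dx _).
suff : 1 <= nu / 2 * x by lra.
apply: (@le_trans _ _ (nu / 2 * (2 / nu))).
  by rewrite mulf_div [2 * nu]mulrC divff // mulf_neq0 // gt_eqF.
by rewrite ler_pM2l // divr_gt0.
Qed.

(** Stating the condition on [q] itself makes the event a preimage of an interval under the random
    variable, hence measurable. *)
Lemma odds_itv (R : realType) (l r q : R) : 0 < l -> 0 < r -> 0 < q < 1 ->
  (odds q \in `]l, r[) = (q \in `]l / (1 + l), r / (1 + r)[).
Proof.
move=> l0 r0 /andP[q0 q1]; rewrite !in_itv /= /odds.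
have q1' : 0 < 1 - q by rewrite subr_gt0.
have l1 : 0 < 1 + l by rewrite addr_gt0.
have r1 : 0 < 1 + r by rewrite addr_gt0.
rewrite ltr_pdivlMr // !ltr_pdivrMr // ltr_pdivlMr //.
by congr (_ && _); rewrite -subr_gt0 -[RHS]subr_gt0; congr (0 < _); ring.
Qed.

Theorem theorem1 (R : realType)
  (d : nat -> measure_display)
  (Omega : forall N : nat, measurableType (d N))
  (Pr : forall N : nat, probability (Omega N) R)
  (p : forall N : nat, 'I_N -> {RV (Pr N) >-> R})
  (I : forall N : nat, {RV (Pr N) >-> nat})
  (pi0 : forall (N : nat) (q : 'I_N -> R) (J : nat), slice N J -> R)
  (zeta l r eta xi eta' : R)
  (hp : forall (N : nat) (omega : Omega N) (n : 'I_N), 0 < p N n omega < 1)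
  (hI : forall (N : nat) (omega : Omega N), (2 <= N)%N ->
     (1 <= I N omega)%N /\ (2 * I N omega <= N)%N)
  (hpi0 : forall (N : nat) (q : 'I_N -> R) (J : nat),
     (forall n : 'I_N, 0 < q n < 1) -> (1 <= J)%N -> (2 * J <= N)%N ->
     is_pmf (pi0 N q J))
  (hzeta : 0 < zeta) (hl : 0 < l) (hlr : l < r) (heta : 0 < eta)
  (hodds : \forall N \near \oo,
     ((1 - expR (- (eta * N%:R)))%:E <=
      Pr N [set omega | (#|[pred n : 'I_N | odds (p N n omega) \notin `]l, r[]|%:R
                         <= zeta * N%:R)%R])%E)
  (hxi : 0 < xi) (hxi2 : xi <= 1 / 2) (heta' : 0 < eta')
  (hsum : \forall N \near \oo,
     ((1 - expR (- (eta' * N%:R)))%:E <=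
      Pr N [set omega | (xi * N%:R <= (I N omega)%:R)%R])%E)
  (hzetaxi : zeta < xi) :
  exists (kappa nu : R) (N0 : nat), 0 < kappa /\ 0 < nu /\
    forall (eps : R) (N : nat), 0 < eps < 1 -> (N0 <= N)%N ->
      holds_with_prob (Pr N) (1 - expR (- (nu * N%:R)))
        [set omega | forall t : nat,
           kappa * N%:R * ln (N%:R / eps) <= t%:R ->
           tv_dist
             (swap_law (fun n : 'I_N => p N n omega)
                (pi0 N (fun n : 'I_N => p N n omega) (I N omega)) t)
             (cond_bernoulli (fun n : 'I_N => p N n omega)) <= eps].
Proof.
set c := (xi - zeta) / 2; set dl := c * (l / (2 * r)); set gam := dl * c / 2.
have [/andP[c0 c1] _ /andP[gam0 gam1]] := rate_bounds hl hlr hzeta hzetaxi hxi2.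
set nu := Num.min eta eta'.
have nu0 : 0 < nu by rewrite lt_min heta.
have [N1 _ hN1] := hodds; have [N2 _ hN2] := hsum.
(* [N3] serves to absorb the factor 2 of the union bound, and [N4] gives [zeta * N + 2 <= xi * N].
   The further threshold 2 is the one under which [hI] bounds [I]. *)
pose N3 := Num.truncn (2 / nu); pose N4 := Num.truncn (2 / (xi - zeta)).
exists (2 / gam), (nu / 2), (maxn (maxn N1 N2) (maxn (maxn N3.+1 N4.+1) 2)).
split; first by rewrite divr_gt0.
split; first by rewrite divr_gt0.
move=> eps N eps01; rewrite !geq_max.
move=> /andP[/andP[nN1 nN2] /andP[/andP[nN3 nN4] n2]].
have tr (u : R) : (Num.truncn u < N)%N -> u <= N%:R.
  by move=> uN; apply: le_trans (ltW (truncnS_gt u)) _; rewrite ler_nat.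
have nuN := tr _ nN3; have zxN := tr _ nN4.
set A := [set omega | #|[pred n : 'I_N | odds (p N n omega) \notin `]l, r[]|%:R
                         <= zeta * N%:R].
set B := [set omega | xi * N%:R <= (I N omega)%:R :> R].
have mA : measurable A.
  pose D (n : 'I_N) := [set omega | odds (p N n omega) \notin `]l, r[].
  have -> : A = [set w | #|[pred n | w \in D n]|%:R <= zeta * N%:R].
    have AD w : #|[pred n : 'I_N | odds (p N n w) \notin `]l, r[]| = #|[pred n | w \in D n]|.
      by apply: eq_card => n; apply/idP/idP => [/mem_set|/set_mem].
    by apply/seteqP; split=> w; rewrite /A /= AD.
  apply: measurable_card_pred => n.
  have -> : D n = ~` (p N n @^-1` `]l / (1 + l), r / (1 + r)[).
    have r0 : 0 < r by exact: lt_trans hlr.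
    by apply/seteqP; split=> w; rewrite /D /= odds_itv // => /negP.
  by apply: measurableC; apply: measurable_funPTI; exact: measurable_itv.
have mB : measurable B by apply: (@measurable_funPTI _ _ _ _ (I N) [set k | xi * N%:R <= k%:R]).
have PAB := probability_setI_ge mA mB (hN1 N nN1) (hN2 N nN2).
exists (A `&` B); split; first exact: measurableI.
  move=> omega [Aw Bw] t ht.
  have [I1 I2] := hI N omega n2.
  apply: le_trans (geometric_mixing _ eps01 n2 ht); last by rewrite gam0.
  apply: swap_law_tv => //.
    rewrite addrC -lerBrDr -mulrBl mulrC -ler_pdivrMr //.
    by rewrite subr_gt0.
  by apply: hpi0.
apply: le_trans PAB; rewrite lee_fin lerD2l lerN2.
apply: le_trans (two_expR_half nu0 nuN); rewrite lerD // ler_expR lerN2.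
  by rewrite ler_wpM2r // ge_min lexx.
by rewrite ler_wpM2r // ge_min lexx orbT.
Qed.
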